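(* Let $(A,\cdot)$ be an associative $K$-algebra with enough idempotents and let $*$ be an associative product on $A$. Then the following are equivalent: (i) $*$ is $(12)$-matching with $\cdot$; (ii) $*$ is interchangeable with $\cdot$; (iii) $*$ is totally compatible with $\cdot$; (iv) $*$ is determined by some $\varphi\in\Gamma(A)$, i.e. $a*b=\varphi(a\cdot b)$ for all $a,b\in A$.
   Context: All algebras and vector spaces are over a field $K$ and all products are binary and bilinear. An associative algebra $A$ has enough idempotents if there is a family of orthogonal idempotents $\{e_i\}_{i\in I}\subseteq A$ such that $A=\bigoplus_{i\in I}e_iA=\bigoplus_{i\in I}Ae_i$. For an associative product $*$ on $A$: - $*$ is $(12)$-matching with $\cdot$ if $(a*b)\cdot c=a\cdot(b*c)$ and $(a\cdot b)*c=a*(b\cdot c)$ for all $a,b,c\in A$; - $*$ is interchangeable with $\cdot$ if $(a*b)\cdot c=(a\cdot b)*c$ and $a*(b\cdot c)=a\cdot(b*c)$ for all $a,b,c\in A$; - $*$ is totally compatible with $\cdot$ if $(a*b)\cdot c=(a\cdot b)*c=a*(b\cdot c)=a\cdot(b*c)$ for all $a,b,c\in A$. The centroid $\Gamma(A)$ is the space of linear maps $\varphi:A\to A$ with $x\cdot\varphi(y)=\varphi(x\cdot y)=\varphi(x)\cdot y$ for all $x,y\in A$. *)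

(* Defs.v *)
From HB Require Import structures.
From mathcomp Require Import all_boot all_order all_algebra.

Set Implicit Arguments.
Unset Strict Implicit.
Unset Printing Implicit Defensive.

Import GRing.Theory.
Local Open Scope ring_scope.

(* MathComp's algebras are unital, so a possibly non-unital associative algebra
   is given here by a vector space [A] together with an associative bilinear
   map [dot : {bilinear A -> A -> A}]. *)

Section CompatibleProducts.
Variables (T : Type) (dot star : T -> T -> T).

Definition matching12 : Prop :=
  forall a b c, dot (star a b) c = dot a (star b c) /\
                star (dot a b) c = star a (dot b c).

Definition interchangeable : Prop :=
  forall a b c, dot (star a b) c = star (dot a b) c /\
                star a (dot b c) = dot a (star b c).

Definition totally_compatible : Prop :=
  forall a b c, [/\ dot (star a b) c = star (dot a b) c,
                    star (dot a b) c = star a (dot b c)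
                  & star a (dot b c) = dot a (star b c)].

End CompatibleProducts.

Section Algebras.
Variables (K : fieldType) (A : lmodType K).

(* [A] is the internal direct sum of the subspaces [V i]: these span [A], and a
   finite sum of elements of distinct [V i] vanishes only trivially.  The index
   set may be infinite. *)
Definition is_direct_sum (I : eqType) (V : I -> A -> Prop) : Prop :=
  (forall a : A, exists (s : seq I) (x : I -> A),
     [/\ uniq s, forall i, i \in s -> V i (x i) & a = \sum_(i <- s) x i]) /\
  (forall (s : seq I) (x : I -> A),
     uniq s -> (forall i, i \in s -> V i (x i)) ->
     \sum_(i <- s) x i = 0 -> forall i, i \in s -> x i = 0).

Variable dot : {bilinear A -> A -> A}.

Definition orthogonal_idempotents (I : eqType) (e : I -> A) : Prop :=
  (forall i, dot (e i) (e i) = e i) /\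
  (forall i j, i != j -> dot (e i) (e j) = 0).

Definition enough_idempotents : Prop :=
  exists (I : eqType) (e : I -> A),
    [/\ orthogonal_idempotents e,
        is_direct_sum (fun i a => exists b, a = dot (e i) b)
      & is_direct_sum (fun i a => exists b, a = dot b (e i))].

Definition in_centroid (phi : {linear A -> A}) : Prop :=
  forall x y, dot x (phi y) = phi (dot x y) /\ phi (dot x y) = dot (phi x) y.

Definition determined_by_centroid (star : A -> A -> A) : Prop :=
  exists phi : {linear A -> A},
    in_centroid phi /\ forall a b, star a b = phi (dot a b).

End Algebras.

(* Main.v *)
Require Import Defs.
From HB Require Import structures.
From mathcomp Require Import all_boot all_order all_algebra.

(** The idempotents matter through the local units which they provide: any
    finite set of elements of A has a common two-sided unit, namely the sum of
    the finitely many e_i that occur when these elements are decomposed along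
    A = sum e_i A and along A = sum A e_i ([enough_idempotents_local_units]).

    Writing products with the dot by juxtaposition, local units turn each
    condition into the next one.  If * is (12)-matching, a left unit g of a and
    of (ab)*c gives
      (ab)*c = g((ab)*c) = (g*(ab))c = ((ga)*b)c = (a*b)c,
    and matching transfers this to the other side.  If * is interchangeable,
    (ab)*c and a*(bc) both equal a(b*u)c when u is a unit of a and b.  If * is
    totally compatible, the vector u*a is the same for all left units u of a
    ([star_left_unit_eq]); call it phi a.  A common unit u of x and y computes
    both phi x and phi y, so phi is linear; moreover
      phi (xy) = u*(xy) = (ux)*y = x*y,
      x(phi y) = x(u*y) = x*(uy) = x*y,
      (phi x)y = (u*x)y = (ux)*y = x*y.  Finally, for phi in the centroid all the
    triple products in question are equal to phi (abc). *)

Import GRing.Theory.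
Local Open Scope ring_scope.

Definition has_local_units {T : eqType} (dot : T -> T -> T) : Prop :=
  forall X : seq T, exists u, {in X, forall x, dot u x = x /\ dot x u = x}.

Lemma local_unit2 (T : eqType) (dot : T -> T -> T) (a b : T) :
    has_local_units dot ->
  exists u, [/\ dot u a = a, dot a u = a, dot u b = b & dot b u = b].
Proof.
move=> units; have [u uP] := units [:: a; b]; exists u.
have [ua au] : dot u a = a /\ dot a u = a by apply: uP; rewrite !inE eqxx.
have [ub bu] : dot u b = b /\ dot b u = b by apply: uP; rewrite !inE eqxx orbT.
by [].
Qed.

Section LocalUnits.
Variables (K : fieldType) (A : lmodType K) (dot : {bilinear A -> A -> A}).

Lemma sum_idempotents_mul (I : eqType) (e : I -> A) (t : seq I) (i : I) :
    orthogonal_idempotents dot e -> uniq t -> i \in t ->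
  dot (\sum_(j <- t) e j) (e i) = e i /\ dot (e i) (\sum_(j <- t) e j) = e i.
Proof.
move=> [ee eo] ut it; rewrite linear_sumr linear_sumlz.
rewrite !(bigD1_seq i) //= ee !big1 ?addr0 // => j ji; apply: eo => //.
by rewrite eq_sym.
Qed.

(** The unit is allowed to range over all larger finite subfamilies so that
    finitely many elements, each with its own support, can share one. *)
Lemma sum_idempotents_unit (I : eqType) (e : I -> A) (x : A) :
    associative dot -> orthogonal_idempotents dot e ->
    is_direct_sum (fun i a => exists b, a = dot (e i) b) ->
    is_direct_sum (fun i a => exists b, a = dot b (e i)) ->
  exists s : seq I, forall t, uniq t -> {subset s <= t} ->
    dot (\sum_(j <- t) e j) x = x /\ dot x (\sum_(j <- t) e j) = x.
Proof.
move=> dotA oe [spanl _] [spanr _].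
have [s [y [_ ye xy]]] := spanl x; have [s' [z [_ ze xz]]] := spanr x.
exists (s ++ s') => t ut st; split.
- rewrite {1}xy [RHS]xy linear_sumr; apply: eq_big_seq => i si.
  have [b ->] := ye i si; rewrite dotA.
  have it : i \in t by apply: st; rewrite mem_cat si.
  by have [-> _] := sum_idempotents_mul I e t i oe ut it.
- rewrite {1}xz [RHS]xz linear_sumlz; apply: eq_big_seq => i si.
  have [b ->] := ze i si; rewrite -dotA.
  have it : i \in t by apply: st; rewrite mem_cat si orbT.
  by have [_ ->] := sum_idempotents_mul I e t i oe ut it.
Qed.

Lemma enough_idempotents_local_units :
  associative dot -> enough_idempotents dot -> has_local_units dot.
Proof.
move=> dotA [I [e [oe suml sumr]]] X.
have [s sX] : exists s : seq I, forall t, uniq t -> {subset s <= t} ->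
    {in X, forall x, dot (\sum_(j <- t) e j) x = x /\
                     dot x (\sum_(j <- t) e j) = x}.
  elim: X => [|x X [s sX]]; first by exists [::].
  have [s' s'x] := sum_idempotents_unit I e x dotA oe suml sumr.
  exists (s' ++ s) => t ut st y; rewrite inE => /predU1P[->|yX].
    by apply: s'x => // i i_s; apply: st; rewrite mem_cat i_s.
  by apply: sX => // i i_s; apply: st; rewrite mem_cat i_s orbT.
exists (\sum_(j <- undup s) e j); apply: sX; first exact: undup_uniq.
by move=> i; rewrite mem_undup.
Qed.

End LocalUnits.

Section Compatibility.
Variables (T : eqType) (dot star : T -> T -> T).

Lemma matching_interchangeable :
  has_local_units dot -> matching12 dot star -> interchangeable dot star.
Proof.
move=> units m12.
have starl a b c : dot (star a b) c = star (dot a b) c.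
  have [g [ga _ gx _]] := local_unit2 T dot a (star (dot a b) c) units.
  by rewrite -[RHS]gx -(m12 g (dot a b) c).1 -(m12 g a b).2 ga.
by move=> a b c; split; rewrite // -(m12 a b c).2 -starl (m12 a b c).1.
Qed.

Lemma interchangeable_totally_compatible :
  has_local_units dot -> associative dot ->
  interchangeable dot star -> totally_compatible dot star.
Proof.
move=> units dotA ic a b c; have [icl icr] := ic a b c.
split=> //; rewrite -icl icr.
have [u [_ au ub bu]] := local_unit2 T dot a b units.
(* u is moved from the left of b to its right: a*b = a(u*b) = a(u(b*u)),
   where au = a. *)
have -> : star a b = dot a (star b u).
  rewrite -{1}ub (ic a u b).2 -{1}bu (ic u b u).2.
  by rewrite dotA au.
by rewrite -{2}bu -(ic b u c).1 dotA.
Qed.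

(** A left unit w of u and v mediates: u*a = (wu)*a = w*(ua) = w*a, and
    likewise for v.  So a |-> u*a, for u any left unit of a, is a well-defined
    map, which is the candidate for the centroid element. *)
Lemma star_left_unit_eq (u v a : T) :
    has_local_units dot -> totally_compatible dot star ->
  dot u a = a -> dot v a = a -> star u a = star v a.
Proof.
move=> units tc ua va; have [w [wu _ wv _]] := local_unit2 T dot u v units.
have [_ tcu _] := tc w u a; have [_ tcv _] := tc w v a.
by rewrite -{1}wu tcu ua -[in RHS]wv tcv va.
Qed.

End Compatibility.

Section Centroid.
Variables (K : fieldType) (A : lmodType K) (dot star : {bilinear A -> A -> A}).

Lemma totally_compatible_determined :
  has_local_units dot -> associative dot ->
  totally_compatible dot star -> determined_by_centroid dot star.
Proof.
move=> units dotA tc.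
have left_unit x : exists u, dot u x == x.
  by have [u [ux _ _ _]] := local_unit2 A dot x x units; exists u; apply/eqP.
pose phi x := star (xchoose (left_unit x)) x.
have phiE u x : dot u x = x -> phi x = star u x.
  move=> ux; apply: (star_left_unit_eq _ dot star _ u x units tc _ ux).
  exact/eqP/(xchooseP (left_unit x)).
have phi_linear : linear phi.
  move=> k x y; have [u [ux _ uy _]] := local_unit2 A dot x y units.
  rewrite (phiE u x ux) (phiE u y uy) (phiE u) ?linearPr //.
  by rewrite ux uy.
have phi_dot x y : phi (dot x y) = star x y.
  have [u [ux _ _ _]] := local_unit2 A dot x x units.
  have [_ tcu _] := tc u x y.
  by rewrite (phiE u) ?dotA ?ux // -tcu ux.
pose phiL : {linear A -> A} :=
  HB.pack phi (GRing.isLinear.Build K A A *:%R phi phi_linear).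
exists phiL; split=> [x y|a b]; last exact/esym/phi_dot.
have -> : phiL (dot x y) = star x y by exact: phi_dot.
rewrite /phiL /=; have [u [ux _ uy _]] := local_unit2 A dot x y units.
rewrite (phiE u x ux) (phiE u y uy); split.
- by have [_ tc2 tc3] := tc x u y; rewrite -tc3 uy.
- by have [tc1 _ _] := tc u x y; rewrite tc1 ux.
Qed.

Lemma determined_matching :
  associative dot -> determined_by_centroid dot star -> matching12 dot star.
Proof.
move=> dotA [phi [phiC starE]] a b c; rewrite !starE.
by rewrite -(phiC _ c).2 (phiC a _).1 dotA.
Qed.

End Centroid.

Theorem proposition3p23 (K : fieldType) (A : lmodType K)
    (dot star : {bilinear A -> A -> A})
    (dotA : associative dot) (idem : enough_idempotents dot)
    (starA : associative star) :
  [<-> matching12 dot star;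
       interchangeable dot star;
       totally_compatible dot star;
       determined_by_centroid dot star].
Proof.
have units := enough_idempotents_local_units K A dot dotA idem.
tfae.
- exact: matching_interchangeable.
- exact: interchangeable_totally_compatible.
- exact: totally_compatible_determined.
- exact: determined_matching.
Qed.
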